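(* Let $a$ and $b$ be relatively prime positive integers. For integers $a_1,b_1$ with $0\le a_1\le b-1$ and $0\le b_1\le a-1$, let $$\chi_{a_1,b_1}=\begin{cases}1, & \text{if } aa_1+bb_1-ab>0,\\ 0, & \text{if } aa_1+bb_1-ab<0.\end{cases}$$ Then the set of integers $\{n: 0\le n\le ab-1\}$ is equal to the set $$\{aa_1+bb_1-ab\,\chi_{a_1,b_1} : 0\le a_1\le b-1,\ 0\le b_1\le a-1\}.$$
   Context: Here $a_1$ and $b_1$ range over integers in the indicated intervals. (The case $aa_1+bb_1=ab$ does not occur for $a_1,b_1$ in these ranges, so $\chi_{a_1,b_1}$ is defined for all of them.) *)

(* Defs.v *)
From mathcomp Require Import all_boot all_order all_algebra.

Set Implicit Arguments.
Unset Strict Implicit.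
Unset Printing Implicit Defensive.

Import Order.TTheory GRing.Theory Num.Theory.
Local Open Scope ring_scope.

(* For coprime positive [a], [b] the equality [a * a1 + b * b1 = a * b] has no
   solution with [0 <= a1 <= b - 1] and [0 <= b1 <= a - 1], so on that range
   the [else] branch is exactly the case [a * a1 + b * b1 - a * b < 0]. *)
Definition chi (a b a1 b1 : int) : int :=
  if 0 < a * a1 + b * b1 - a * b then 1 else 0.

(* Main.v *)
(** Reducing [a a1 + b b1] by [a b chi] is reduction modulo [a b]: the sum lies
    in [[0, 2ab)], and coprimality prevents it from being equal to [a b].  So
    every value lies in [[0, ab)], and conversely a Bezout relation
    [u a + v b = 1] writes [n] modulo [a b] as [a (n u mod b) + b (n v mod a)]. *)
Require Import Defs.
From mathcomp Require Import all_boot all_order all_algebra.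
From mathcomp Require Import classical_sets.
From mathcomp Require Import zify ring.

Set Implicit Arguments.
Unset Strict Implicit.
Unset Printing Implicit Defensive.

Import Order.TTheory GRing.Theory Num.Theory.
Local Open Scope classical_set_scope.
Local Open Scope ring_scope.

(** Equality would give [b * b1 = a * (b - a1)], so [a] divides [b1] by Gauss; the range of [b1]
    then forces [b1 = 0], whence [a1 = b]. *)
Lemma coprimez_comb_neq_mul (a b a1 b1 : int) :
  0 < a -> coprimez a b -> a1 < b -> 0 <= b1 < a ->
  a * a1 + b * b1 != a * b.
Proof.
move=> a_gt0 co_ab lt_a1b /andP[b1_ge0 lt_b1a]; apply/eqP => eq_ab.
have a_dvd_b1 : (a %| b1)%Z.
  rewrite -(Gauss_dvdzr _ co_ab); apply/dvdzP; exists (b - a1).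
  by rewrite mulrBl [b * a]mulrC -eq_ab [a1 * a]mulrC addrC addKr.
have b1_eq0 : b1 = 0.
  by move/dvdz_mod0P: a_dvd_b1; rewrite modz_small // b1_ge0.
move: eq_ab; rewrite b1_eq0 mulr0 addr0 => /(mulfI (lt0r_neq0 a_gt0)) eq_a1b.
by rewrite eq_a1b ltxx in lt_a1b.
Qed.

Lemma subr_chi_modz (a b a1 b1 : int) :
  coprimez a b -> 0 <= a1 < b -> 0 <= b1 < a ->
  a * a1 + b * b1 - a * b * chi a b a1 b1 = ((a * a1 + b * b1) %% (a * b))%Z.
Proof.
move=> co_ab /andP[a1_ge0 lt_a1b] /andP[b1_ge0 lt_b1a].
have a_gt0 : 0 < a by exact: le_lt_trans lt_b1a.
have b_gt0 : 0 < b by exact: le_lt_trans lt_a1b.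
have ab_gt0 : 0 < a * b by exact: mulr_gt0.
have neq_ab : a * a1 + b * b1 != a * b.
  by apply: coprimez_comb_neq_mul; rewrite ?b1_ge0.
have S_ge0 : 0 <= a * a1 + b * b1 by rewrite addr_ge0 // mulr_ge0 // ltW.
have S_lt2 : a * a1 + b * b1 < a * b + a * b.
  by apply: ltrD; [|rewrite [ltRHS]mulrC]; rewrite ltr_pM2l.
rewrite /chi subr_gt0; case: ltP => [gt_ab | le_ab].
  rewrite mulr1 -[in RHS](subrK (a * b) (_ + _)) modzDr modz_small //.
  by rewrite subr_ge0 ltW //= ltrBlDr.
(* The failed test only yields [<=]; [neq_ab] makes it strict, which matters because a sum equal to
   [a * b] would have remainder 0. *)
by rewrite mulr0 subr0 modz_small // S_ge0 lt_neqAle neq_ab.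
Qed.

Theorem theorem5 (a b : int) (ha : 0 < a) (hb : 0 < b) (hab : coprimez a b) :
  [set n : int | 0 <= n <= a * b - 1] =
  [set a * a1 + b * b1 - a * b * chi a b a1 b1
    | a1 in [set i : int | 0 <= i <= b - 1]
    & b1 in [set j : int | 0 <= j <= a - 1]].
Proof.
have ab_gt0 : 0 < a * b by exact: mulr_gt0.
have le_pred (m n : int) : (m <= n - 1) = (m < n) by lia.
apply/seteqP; split=> [n /=|_ [a1 /= + [b1 /= + <-]]]; rewrite !le_pred.
  move=> /andP[n_ge0 lt_n_ab].
  have /coprimezP[[u v] /= uv1] := hab.
  have a1_bounds : 0 <= (n * u %% b)%Z < b by rewrite modz_ge0 ?gt_eqF ?ltz_pmod.
  have b1_bounds : 0 <= (n * v %% a)%Z < a by rewrite modz_ge0 ?gt_eqF ?ltz_pmod.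
  exists (n * u %% b)%Z; rewrite /= ?le_pred //.
  exists (n * v %% a)%Z; rewrite /= ?le_pred // subr_chi_modz //.
  (* Each remainder is the dividend minus divisor times quotient, so both corrections are multiples
     of [a * b]; what is left is [n * (u * a + v * b)], which is [n] by [uv1]. *)
  have -> : a * (n * u %% b)%Z + b * (n * v %% a)%Z =
      - ((n * u %/ b)%Z + (n * v %/ a)%Z) * (a * b) + n.
    by rewrite /modz -[X in _ = _ + X]mulr1 -uv1; ring.
  by rewrite modzMDl modz_small // n_ge0.
move=> a1_bounds b1_bounds.
by rewrite subr_chi_modz // modz_ge0 ?gt_eqF ?ltz_pmod.
Qed.
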